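(* Let $\mathcal H$ be a complex Hilbert space of finite dimension $d\ge 2$, and let $w$ be a context-indexed probability assignment on $\mathfrak M(\mathcal H)$. For every nonzero orthogonal projection $P$ on $\mathcal H$ and every $\mathsf M,\mathsf N\in\mathfrak M_P$, $$|w(P,\mathsf M)-w(P,\mathsf N)|\le\min\Bigl\{\bigl(c_P(\mathsf M)+c_P(\mathsf N)\bigr)\operatorname{def}^{\mathrm{ref}}_P(w),\ d_{n_P}\bigl(\lambda_P(\mathsf M),\lambda_P(\mathsf N)\bigr)\operatorname{def}^{\mathrm{ref}}_P(w)+\operatorname{def}^{G}_P(w)\Bigr\}.$$ In particular, $$|w(P,\mathsf M)-w(P,\mathsf N)|\le\min\Bigl\{\bigl(c_P(\mathsf M)+c_P(\mathsf N)\bigr)\operatorname{def}^{\mathrm{ref}}_P(w),\ \bigl(s_P(\mathsf M)+s_P(\mathsf N)\bigr)\operatorname{def}^{\mathrm{ref}}_P(w)+\operatorname{def}^{G}_P(w)\Bigr\}.$$ Consequently, with $m_P=\max\{n_P-1,0\}$, $$\operatorname{def}^{G}_P(w)\le 2m_P\operatorname{def}^{\mathrm{ref}}_P(w)$$ and $$\operatorname{osc}_P(w)\le m_P\operatorname{def}^{\mathrm{ref}}_P(w)+\tfrac12\operatorname{def}^{G}_P(w)\le 2m_P\operatorname{def}^{\mathrm{ref}}_P(w).$$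
   Context: A projective measurement on $\mathcal H$ is an unordered finite family (set) $\mathsf M=\{P_1,\dots,P_m\}$ of nonzero pairwise orthogonal orthogonal projections on $\mathcal H$ with $\sum_{j=1}^m P_j=I$. $\mathfrak M(\mathcal H)$ is the set of all projective measurements, and $\mathfrak M_P=\{\mathsf M\in\mathfrak M(\mathcal H):P\in\mathsf M\}$. For $P\in\mathsf M$, the complementary rank profile $\lambda_P(\mathsf M)$ is the nondecreasing tuple listing (with multiplicity) the ranks of the projections in $\mathsf M\setminus\{P\}$; it is an integer partition of $n_P:=d-\operatorname{rank}P$ (the empty partition if $P=I$). A context-indexed probability assignment on $\mathfrak M(\mathcal H)$ is a function $w:\{(P,\mathsf M):\mathsf M\in\mathfrak M(\mathcal H),\ P\in\mathsf M\}\to[0,1]$ with $\sum_{P\in\mathsf M}w(P,\mathsf M)=1$ for every $\mathsf M$. $G_P=\{U\in\mathcal U(\mathcal H):Ux=x\text{ for every }x\in\operatorname{ran}P\}$, where $\mathcal U(\mathcal H)$ is the unitary group, and $U\mathsf M U^*:=\{UQU^*:Q\in\mathsf M\}$. Elementary refinement: $\mathsf M'\succ_P\mathsf M$ means that $\mathsf M,\mathsf M'$ are projective measurements and there are an outcome $Q\in\mathsf M$ and nonzero mutually orthogonal projections $Q_1,Q_2$ with $Q=Q_1+Q_2$, $\mathsf M'=(\mathsf M\setminus\{Q\})\cup\{Q_1,Q_2\}$, and $P\in\mathsf M\setminus\{Q\}$. Rank-profile refinement graph: for $n\ge 0$, $\Gamma_n$ is the finite graph whose vertices are the integer partitions of $n$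 (only the empty partition when $n=0$), two partitions being adjacent when one is obtained from the other by replacing one part $r$ by two positive parts $a,b$ with $a+b=r$; $d_n$ is the graph distance in $\Gamma_n$. For $P\in\mathsf M$ set $k_P(\mathsf M)=|\mathsf M\setminus\{P\}|$, $c_P(\mathsf M)=\max\{k_P(\mathsf M)-1,0\}$ and $s_P(\mathsf M)=n_P-k_P(\mathsf M)$. Defects and oscillation: $$\operatorname{def}^{G}_P(w)=\sup_{\mathsf M\in\mathfrak M_P,\,U\in G_P}|w(P,U\mathsf MU^* )-w(P,\mathsf M)|,\qquad \operatorname{def}^{\mathrm{ref}}_P(w)=\sup_{\mathsf M'\succ_P\mathsf M}|w(P,\mathsf M')-w(P,\mathsf M)|,$$ $$\operatorname{osc}_P(w)=\sup_{\mathsf M,\mathsf N\in\mathfrak M_P}|w(P,\mathsf M)-w(P,\mathsf N)|,$$ where the supremum over an empty family is defined to be zero. *)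

(* Defs.v *)
From HB Require Import structures.
From mathcomp Require Import all_boot all_order all_algebra.
From mathcomp Require Import finmap complex.
From mathcomp Require Import all_classical all_reals.

Set Implicit Arguments.
Unset Strict Implicit.
Unset Printing Implicit Defensive.
Import Order.TTheory GRing.Theory Num.Theory.

Local Open Scope ring_scope.

(* A finite-dimensional complex Hilbert space is given by [H : vectType R[i]]
   with a positive definite Hermitian form [dot : {dot H for Num.conj}], linear
   in its first argument; completeness is automatic in finite dimension. *)
Section Operators.
Variables (R : realType) (H : vectType R[i]) (dot : {dot H for Num.conj}).
Implicit Types f g P Q U : 'End(H).

Lemma adj_exists f : exists g : 'End(H), forall u v, dot (f u) v = dot u (g v).
Proof.
set n := \dim {:H}.
pose e (i : 'I_n) := (vbasis {:H})`_i.
pose T h (v : H) : 'rV[R[i]]_n := \row_i dot v (h (e i)).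
have Tlin h : linear (T h).
  by move=> a u v; apply/rowP=> i; rewrite !mxE linearPl.
pose TL h : {linear H -> 'rV[R[i]]_n} :=
  HB.pack (T h) (GRing.isLinear.Build _ _ _ _ (T h) (Tlin h)).
pose F h := linfun (TL h).
have FE h v i : F h v 0 i = dot v (h (e i)) by rewrite lfunE /= mxE.
have dext (a b : H) : (forall i, dot a (e i) = dot b (e i)) ->
    forall x, dot a x = dot b x.
  move=> ab x; rewrite (coord_vbasis (memvf x)) !linear_sumr.
  by apply: eq_bigr => i _; rewrite !linearZr_LR /= ab.
have kerF : lker (F \1%VF) == 0%VS.
  apply/lker0P => u v /rowP uv; apply/eqP; rewrite -subr_eq0 -(dnorm_eq0 dot).
  rewrite linearBl /= subr_eq0; apply/eqP; apply: dext => i.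
  by have := uv i; rewrite !FE !lfunE.
have imF : limg (F \1%VF) = fullv.
  apply/eqP; rewrite eqEdim subvf /= limg_dim_eq; last first.
    by move/eqP: kerF => ->; rewrite capv0.
  by rewrite dimvf /dim /= mul1n.
exists ((F \1%VF)^-1 \o F f)%VF => u v.
rewrite (hermC dot) [RHS](hermC dot) !expr0 !mul1r; congr (Num.conj _).
rewrite comp_lfunE /=.
set w := ((F \1%VF)^-1)%VF _.
have Fw : F \1%VF w = F f v by rewrite limg_lfunVK // imF memvf.
have wE i : dot w (e i) = dot v (f (e i)).
  by have /rowP/(_ i) := Fw; rewrite !FE lfunE.
rewrite (coord_vbasis (memvf u)) linear_sum /= !linear_sumr.
by apply: eq_bigr => i _; rewrite linearZ /= !linearZr_LR /= wE.
Qed.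

Definition adj f : 'End(H) := projT1 (cid (adj_exists f)).

Lemma adjP f u v : dot (f u) v = dot u (adj f v).
Proof. exact: (projT2 (cid (adj_exists f))). Qed.

Definition orth_proj P : Prop := (P \o P)%VF = P /\ adj P = P.

Definition orth_ops P Q : Prop := (P \o Q)%VF = 0 /\ (Q \o P)%VF = 0.

Definition unitary U : Prop :=
  (adj U \o U)%VF = \1%VF /\ (U \o adj U)%VF = \1%VF.

Definition rk P : nat := \dim (limg P).

Definition codim P : nat := (\dim {:H} - rk P)%N.

Definition is_pm (M : {fset 'End(H)}) : Prop :=
  [/\ forall P, P \in M -> orth_proj P /\ P != 0,
      forall P Q, P \in M -> Q \in M -> P != Q -> orth_ops P Q
    & \sum_(P <- M) P = \1%VF].

Definition pm_at P (M : {fset 'End(H)}) : Prop := is_pm M /\ P \in M.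

Definition fixes_range P U : Prop :=
  unitary U /\ forall x, x \in limg P -> U x = x.

Definition conj_pm U (M : {fset 'End(H)}) : {fset 'End(H)} :=
  [fset (U \o Q \o adj U)%VF | Q in M]%fset.

(* [refines P M' M] is the relation M' >-_P M. *)
Definition refines P (M' M : {fset 'End(H)}) : Prop :=
  [/\ is_pm M, is_pm M' & exists Q Q1 Q2 : 'End(H),
    [/\ Q \in M,
        [/\ orth_proj Q1, Q1 != 0, orth_proj Q2, Q2 != 0 & orth_ops Q1 Q2],
        Q = Q1 + Q2,
        M' = ((M `\ Q) `|` [fset Q1; Q2])%fset
      & P \in (M `\ Q)%fset]].

Definition rank_profile P (M : {fset 'End(H)}) : seq nat :=
  sort leq [seq rk Q | Q <- (M `\ P)%fset].

Definition kP P (M : {fset 'End(H)}) : nat := #|` (M `\ P)%fset |.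

Definition cP P M : nat := maxn (kP P M - 1) 0.

(* The truncated subtraction is exact: k_P <= n_P, as all ranks are positive. *)
Definition sP P M : nat := (codim P - kP P M)%N.

Definition mP P : nat := maxn (codim P - 1) 0.

(* [w P M] stands for w(P, M); its values outside of the pairs with M a
   projective measurement and P \in M are irrelevant. *)
Definition assignment (w : 'End(H) -> {fset 'End(H)} -> R) : Prop :=
  forall M, is_pm M ->
    (forall P, P \in M -> 0 <= w P M <= 1) /\ \sum_(P <- M) w P M = 1.

(* In the next three definitions, [sup set0 = 0] is the convention for empty
   families, and all the families are bounded when [assignment w]. *)
Definition defG (w : 'End(H) -> {fset 'End(H)} -> R) P : R :=
  sup [set r : R | exists M U, [/\ pm_at P M, fixes_range P U
                                 & r = `|w P (conj_pm U M) - w P M| ]]%classic.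

Definition defref (w : 'End(H) -> {fset 'End(H)} -> R) P : R :=
  sup [set r : R | exists M M', refines P M' M
                                /\ r = `|w P M' - w P M| ]%classic.

Definition osc (w : 'End(H) -> {fset 'End(H)} -> R) P : R :=
  sup [set r : R | exists M N, [/\ pm_at P M, pm_at P N
                                 & r = `|w P M - w P N| ]]%classic.

End Operators.

(* Integer partitions are represented by nondecreasing lists of parts. *)
Definition is_partition (n : nat) (s : seq nat) : bool :=
  [&& sorted leq s, all (fun r => 0 < r)%N s & sumn s == n].

Definition splits_to (s t : seq nat) : Prop :=
  exists r a b : nat, [/\ r \in s, (0 < a)%N, (0 < b)%N, (a + b)%N = r
                        & perm_eq t [:: a, b & rem r s]].

Definition Gamma (n : nat) : rel (seq nat) := fun s t =>
  [&& is_partition n s, is_partition n t & `[< splits_to s t \/ splits_to t s >]].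

Definition walk (n : nat) (s t : seq nat) (k : nat) : Prop :=
  exists p : seq (seq nat), [/\ path (Gamma n) s p, last s p = t & size p = k].

(* The graph [Gamma n] is connected (every partition is joined to 1 + ... + 1),
   so that the default value 0 is never used for two partitions of n. *)
Definition pdist (n : nat) (s t : seq nat) : nat :=
  xget 0%N [set k | walk n s t k /\ forall j, walk n s t j -> (k <= j)%N]%classic.

(* Main.v *)
(* Merging outcomes of M other than P one pair at a time ends, after c_P(M)
   elementary steps, at the two-outcome measurement {P, I - P}, which does not
   depend on M; comparing M and N through it gives the first bound.

   An edge of the rank-profile graph out of lambda_P(M) lifts to an elementary
   refinement or coarsening of M, because a projection of rank a + b is a sum of
   orthogonal projections of ranks a and b.  Lifting a geodesic from lambda_P(M)
   to lambda_P(N) gives a measurement M* with the profile of N; as M* and N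
   contain P and have equal ranks, summing P and partial isometries between
   matched outcomes gives a unitary of G_P that maps M* to N.  The geodesic is no
   longer than the walk through 1 + ... + 1, of length s_P(M) + s_P(N).

   The bound on the oscillation is the average of the two bounds, as
   c_P + s_P = m_P. *)
Require Import Defs.
From HB Require Import structures.
From mathcomp Require Import all_boot all_order all_algebra.
From mathcomp Require Import finmap complex.
From mathcomp Require Import all_classical all_reals.
Import Order.TTheory GRing.Theory Num.Theory.
Local Open Scope ring_scope.

Set Implicit Arguments.
Unset Strict Implicit.
Unset Printing Implicit Defensive.

Reserved Notation "f ^†" (at level 2, format "f ^†").

(** * Adjoints and rank-one operators *)

Section OperatorTheory.
Variables (R : realType) (H : vectType R[i]) (dot : {dot H for Num.conj}).
Implicit Types (f g P Q A B U V : 'End(H)) (u v x : H) (s t : seq 'End(H)).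
Local Notation "f ^†" := (adj dot f).
Local Notation orth_proj := (orth_proj dot).

Lemma dot_inj u v : (forall x, dot x u = dot x v) -> u = v.
Proof.
move=> uv; apply/eqP; rewrite -subr_eq0 -(dnorm_eq0 dot).
by rewrite linearBr /= uv subrr.
Qed.

Lemma adj_unique f g : (forall u v, dot (f u) v = dot u (g v)) -> f^† = g.
Proof. by move=> fg; apply/lfunP=> v; apply: dot_inj => u; rewrite -adjP fg. Qed.

Lemma dotC u v : dot u v = Num.conj (dot v u).
Proof. by rewrite (hermC dot) expr0 mul1r. Qed.

Lemma adjK f : (f^†)^† = f.
Proof. by apply: adj_unique => u v; rewrite dotC -adjP -dotC. Qed.

Lemma adjD f g : (f + g)^† = f^† + g^†.
Proof.
by apply: adj_unique => u v; rewrite !add_lfunE linearDl linearDr /= !adjP.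
Qed.

Lemma adjN f : (- f)^† = - f^†.
Proof.
by apply: adj_unique => u v; rewrite !opp_lfunE linearNl linearNr /= !adjP.
Qed.

Lemma adj0 : (0 : 'End(H))^† = 0.
Proof.
by apply: adj_unique => u v; rewrite !zero_lfunE linear0l linear0r.
Qed.

Lemma adjM f g : (f \o g)%VF^† = (g^† \o f^†)%VF.
Proof. by apply: adj_unique => u v; rewrite !comp_lfunE /= !adjP. Qed.

(** The squared norm of [V (f x)] is the product of [f x] with [V^† (V (f x))]. *)
Lemma adj_comp_eq0 V f : (V^† \o (V \o f))%VF = 0 -> (V \o f)%VF = 0.
Proof.
move=> /lfunP VVf; apply/lfunP => x; apply/eqP.
have := VVf x; rewrite !comp_lfunE !zero_lfunE => VVfx.
by rewrite -(dnorm_eq0 dot) adjP VVfx linear0r.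
Qed.

Fact ketbra_subproof u v : linear (fun x => dot x v *: u).
Proof. by move=> a x y; rewrite linearPl /= scalerDl scalerA. Qed.

Definition ketbra u v : 'End(H) :=
  linfun (HB.pack_for {linear H -> H} (fun x => dot x v *: u)
    (GRing.isLinear.Build _ _ _ _ (fun x => dot x v *: u) (ketbra_subproof u v))).

Lemma ketbraE u v x : ketbra u v x = dot x v *: u.
Proof. by rewrite lfunE. Qed.

Lemma adj_ketbra u v : (ketbra u v)^† = ketbra v u.
Proof.
apply: adj_unique => x y; rewrite !ketbraE linearZl_LR linearZr_LR /=.
by rewrite mulrC -dotC.
Qed.

Lemma comp_ketbra_l f u v : (f \o ketbra u v)%VF = ketbra (f u) v.
Proof. by apply/lfunP => x; rewrite comp_lfunE !ketbraE linearZ. Qed.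

Lemma orth_proj_ketbra u : dot u u = 1 -> orth_proj (ketbra u u).
Proof.
by move=> u1; split; rewrite ?adj_ketbra // comp_ketbra_l ketbraE u1 scale1r.
Qed.

Lemma rk_ketbra u : dot u u = 1 -> rk (ketbra u u) = 1.
Proof.
move=> u1; rewrite /rk; suff -> : limg (ketbra u u) = <[u]>%VS.
  rewrite dim_vline; case: eqP => // u0.
  by move: u1; rewrite u0 linear0l => /esym/eqP; rewrite oner_eq0.
apply/eqP; rewrite eqEsubv; apply/andP; split.
  by apply/subvP => _ /memv_imgP[x _ ->]; rewrite ketbraE memvZ ?memv_line.
apply/subvP => _ /vlineP[k ->]; rewrite memvZ //.
by apply/memv_imgP; exists u; rewrite ?memvf // ketbraE u1 scale1r.
Qed.

(** * Orthogonal projections and their ranks *)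

Lemma orth_ops_sym P Q : orth_ops P Q -> orth_ops Q P.
Proof. by case. Qed.

Lemma orth_opsP P Q : orth_proj P -> orth_proj Q -> (P \o Q)%VF = 0 -> orth_ops P Q.
Proof.
by move=> [_ Ps] [_ Qs] PQ; split=> //; rewrite -[RHS]adj0 -PQ adjM Ps Qs.
Qed.

Lemma orth_ops0 Q : orth_ops Q 0.
Proof. by split; rewrite ?comp_lfun0l ?comp_lfun0r. Qed.

Lemma orth_opsD P Q1 Q2 : orth_ops P Q1 -> orth_ops P Q2 -> orth_ops P (Q1 + Q2).
Proof.
by move=> [P1 P1'] [P2 P2']; split;
  rewrite ?comp_lfunDl ?comp_lfunDr ?P1 ?P1' ?P2 ?P2' addr0.
Qed.

(** Since [Q1] factors as [(Q1 + Q2) \o Q1], it is killed by [P] as soon as the sum is. *)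
Lemma orth_ops_addl P Q1 Q2 : orth_proj P -> orth_proj Q1 -> orth_proj Q2 ->
  orth_ops Q1 Q2 -> orth_ops P (Q1 + Q2) -> orth_ops P Q1.
Proof.
move=> hP h1 h2 [_ Q21] [PQ _]; apply: orth_opsP => //.
have -> : Q1 = ((Q1 + Q2) \o Q1)%VF by rewrite comp_lfunDl Q21 h1.1 addr0.
by rewrite comp_lfunA PQ comp_lfun0l.
Qed.

Lemma orth_proj0 : orth_proj 0.
Proof. by split; rewrite ?comp_lfun0l ?adj0. Qed.

Lemma orth_projD P Q : orth_proj P -> orth_proj Q -> orth_ops P Q ->
  orth_proj (P + Q).
Proof.
move=> [Pi Ps] [Qi Qs] [PQ QP]; split; last by rewrite adjD Ps Qs.
by rewrite comp_lfunDl !comp_lfunDr Pi Qi PQ QP addr0 add0r.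
Qed.

Lemma orth_projB P Q : orth_proj P -> orth_proj Q -> (P \o Q)%VF = Q ->
  orth_proj (P - Q).
Proof.
move=> [Pi Ps] [Qi Qs] PQ; have QP : (Q \o P)%VF = Q.
  by rewrite -{1}Qs -{1}Ps -adjM PQ.
split; last by rewrite adjD adjN Ps Qs.
rewrite comp_lfunDl !comp_lfunDr !comp_lfunNl !comp_lfunNr.
by rewrite Pi Qi PQ QP opprK addNr addr0.
Qed.

Lemma rkD P Q : orth_proj P -> orth_proj Q -> orth_ops P Q ->
  rk (P + Q) = (rk P + rk Q)%N.
Proof.
move=> [Pi _] [Qi _] [PQ QP].
have PE x : P (P x) = P x by rewrite -comp_lfunE Pi.
have QE x : Q (Q x) = Q x by rewrite -comp_lfunE Qi.
have PQE x : P (Q x) = 0 by rewrite -comp_lfunE PQ zero_lfunE.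
have QPE x : Q (P x) = 0 by rewrite -comp_lfunE QP zero_lfunE.
(* The two ranges meet only in 0, and their sum is the range of [P + Q] because [P x] is the value
   of [P + Q] at [P x], and likewise for [Q]. *)
rewrite /rk -dimv_disjoint_sum; last first.
  apply/eqP; rewrite -subv0; apply/subvP => x; rewrite memv_cap memv0.
  case/andP => /memv_imgP[y _ ->] /memv_imgP[z _ yz].
  by rewrite -PE yz PQE.
congr (\dim _); apply/eqP; rewrite eqEsubv; apply/andP; split.
  apply/subvP => _ /memv_imgP[x _ ->]; rewrite add_lfunE.
  by rewrite memv_add // memv_img // memvf.
rewrite subv_add; apply/andP; split; apply/subvP => _ /memv_imgP[x _ ->];
  apply/memv_imgP; [exists (P x)|exists (Q x)]; rewrite ?memvf // add_lfunE.
  by rewrite PE QPE addr0.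
by rewrite QE PQE add0r.
Qed.

Lemma rk0 : rk (0 : 'End(H)) = 0%N.
Proof. by rewrite /rk; apply/eqP; rewrite dimv_eq0 lim0g. Qed.

Lemma rk1 : rk (\1%VF : 'End(H)) = \dim {:H}.
Proof. by rewrite /rk lim1g. Qed.

Lemma rk_eq0 P : (rk P == 0%N) = (P == 0).
Proof.
apply/idP/eqP => [|->]; last by rewrite rk0.
rewrite /rk dimv_eq0 => /eqP P0; apply/lfunP => x; apply/eqP.
by rewrite zero_lfunE -memv0 -P0 memv_img ?memvf.
Qed.

(** Normalising a nonzero vector of the range gives [u]. Removing its line lowers the rank by one,
    which drives the inductions on rank below. *)
Lemma rk_peel Q : orth_proj Q -> Q != 0 -> exists u,
  [/\ dot u u = 1, orth_proj (Q - ketbra u u),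
      orth_ops (ketbra u u) (Q - ketbra u u)
    & rk Q = (rk (Q - ketbra u u)).+1].
Proof.
move=> Qp Q0.
have [x Qx0] : exists x, Q x != 0.
  apply: contrapT => h; move/eqP: Q0; apply; apply/lfunP => x.
  by rewrite zero_lfunE; apply/eqP; apply: contrapT => /negP ?; apply: h; exists x.
pose c := sqrtC (dot (Q x) (Q x)); pose u := c^-1 *: Q x.
have c_gt0 : 0 < c by rewrite sqrt_dnorm_gt0.
have u1 : dot u u = 1.
  rewrite dnormZ normfV gtr0_norm // exprVn sqrtCK mulVf //.
  by rewrite dnorm_eq0.
have Qu : Q u = u by rewrite linearZ /= -comp_lfunE Qp.1.
have Kp := orth_proj_ketbra u1.
have QK : (Q \o ketbra u u)%VF = ketbra u u by rewrite comp_ketbra_l Qu.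
have QKp := orth_projB Qp Kp QK.
have oKQ : orth_ops (ketbra u u) (Q - ketbra u u).
  apply: orth_ops_sym; apply: orth_opsP => //.
  by rewrite comp_lfunDl comp_lfunNl QK Kp.1 subrr.
exists u; split => //.
by rewrite -[in LHS](subrKC (ketbra u u) Q) (rkD Kp) // (rk_ketbra u1).
Qed.

(** Peel off [a] unit vectors one at a time: their rank-one projections add up to [Q1], and what is
    left is [Q2]. *)
Lemma orth_proj_split Q (a b : nat) : orth_proj Q -> rk Q = (a + b)%N ->
  exists Q1 Q2, [/\ orth_proj Q1, orth_proj Q2, orth_ops Q1 Q2, Q = Q1 + Q2
                  & rk Q1 = a /\ rk Q2 = b].
Proof.
elim: a Q => [|a IHa] Q Qp rQ.
  exists 0, Q; rewrite add0r rk0; split=> //; first exact: orth_proj0.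
  exact/orth_ops_sym/orth_ops0.
have [|u [u1 Qp' oQ rkQ]] := rk_peel Qp; first by rewrite -rk_eq0 rQ.
have [|Q1 [Q2 [p1 p2 o12 Q'E [r1 r2]]]] := IHa _ Qp'.
  by move: rkQ; rewrite rQ => -[].
have Kp := orth_proj_ketbra u1; rewrite Q'E in oQ.
have oK1 := orth_ops_addl Kp p1 p2 o12 oQ.
have oK2 : orth_ops (ketbra u u) Q2.
  by apply: (@orth_ops_addl _ _ Q1) => //; [exact: orth_ops_sym|rewrite addrC].
exists (ketbra u u + Q1), Q2; split=> //.
- exact: orth_projD.
- by apply/orth_ops_sym/orth_opsD; apply: orth_ops_sym.
- by rewrite -addrA -Q'E subrKC.
- by rewrite rkD // rk_ketbra // r1.
Qed.

(** * Partial isometries between projections of equal rank *)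

Definition partial_isom A B V := (V^† \o V)%VF = A /\ (V \o V^†)%VF = B.

Lemma partial_isom_comp_eq0 A B V f : partial_isom A B V -> (A \o f)%VF = 0 -> (V \o f)%VF = 0.
Proof. by move=> [VV _] Af; apply: adj_comp_eq0; rewrite comp_lfunA VV. Qed.

Lemma partial_isom_adj A B V : partial_isom A B V -> partial_isom B A V^†.
Proof. by move=> [VA VB]; split; rewrite adjK. Qed.

Lemma partial_isomD A1 A2 B1 B2 V1 V2 : partial_isom A1 B1 V1 -> partial_isom A2 B2 V2 ->
  orth_ops A1 A2 -> orth_ops B1 B2 -> partial_isom (A1 + A2) (B1 + B2) (V1 + V2).
Proof.
(* From A' A = 0 follows V' A = 0, hence A V'^† = 0 by taking adjoints, hence V V'^† = 0. Applied to
   the adjoint isometries, this also removes the other pair of cross terms. *)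
have cross A A' B B' V V' : partial_isom A B V -> partial_isom A' B' V' ->
    (A' \o A)%VF = 0 -> (V \o V'^†)%VF = 0.
  move=> iV iV' AA; apply: (partial_isom_comp_eq0 iV).
  have AE : A^† = A by rewrite -iV.1 adjM adjK.
  rewrite -[LHS]adjK adjM adjK AE.
  by rewrite (partial_isom_comp_eq0 iV') // adj0.
move=> i1 i2 [A12 A21] [B12 B21]; split; rewrite adjD comp_lfunDl !comp_lfunDr.
  have c12 := cross _ _ _ _ _ _ (partial_isom_adj i1) (partial_isom_adj i2) B21.
  have c21 := cross _ _ _ _ _ _ (partial_isom_adj i2) (partial_isom_adj i1) B12.
  by rewrite !adjK in c12 c21; rewrite c12 c21 i1.1 i2.1 addr0 add0r.
have c12 := cross _ _ _ _ _ _ i1 i2 A21.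
have c21 := cross _ _ _ _ _ _ i2 i1 A12.
by rewrite c12 c21 i1.2 i2.2 addr0 add0r.
Qed.

Lemma partial_isom_self A : orth_proj A -> partial_isom A A A.
Proof. by move=> [Ai As]; split; rewrite As. Qed.

Lemma partial_isom_exists A B : orth_proj A -> orth_proj B -> rk A = rk B ->
  exists V, partial_isom A B V.
Proof.
move: {2}(rk A) (erefl (rk A)) => n; elim: n A B => [|n IHn] A B rA Ap Bp rAB.
  move/eqP: rA (rAB); rewrite rk_eq0 => /eqP ->; rewrite rk0 => /esym/eqP.
  by rewrite rk_eq0 => /eqP ->; exists 0; apply/partial_isom_self/orth_proj0.
have [|u [u1 Ap' oA rkA]] := rk_peel Ap; first by rewrite -rk_eq0 rA.
have [|v [v1 Bp' oB rkB]] := rk_peel Bp; first by rewrite -rk_eq0 -rAB rA.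
have [||V iV] := IHn _ _ _ Ap' Bp'.
- by move: rA; rewrite rkA => -[].
- by move: rAB; rewrite rkA rkB => -[].
(* [ketbra v u] carries the unit vector peeled from [A] to the one peeled from [B]; [V] matches the
   remainders. *)
exists (ketbra v u + V).
rewrite -[A](subrKC (ketbra u u)) -[B](subrKC (ketbra v v)); apply: partial_isomD => //.
by split; rewrite adj_ketbra comp_ketbra_l ketbraE ?u1 ?v1 scale1r.
Qed.

End OperatorTheory.

(** Used with [f] the rank: outcomes can be reordered so that their ranks come in a prescribed
    order. *)
Lemma perm_map_exists (T1 T2 : eqType) (f : T1 -> T2) (s : seq T1) (t : seq T2) :
  perm_eq (map f s) t -> exists2 s', perm_eq s s' & map f s' = t.
Proof.
elim: t s => [|y t IHt] s.
  by move/perm_size; rewrite size_map => /size0nil ->; exists [::].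
move=> st; have : y \in map f s by rewrite (perm_mem st) mem_head.
case/mapP => x xs yE; have sE := perm_to_rem xs.
have [|s' ss' fs'] := IHt (rem x s).
  by move: st; rewrite (permPl (perm_map f sE)) /= -yE perm_cons.
by exists (x :: s'); rewrite ?(perm_trans sE) ?perm_cons //= fs' yE.
Qed.

(** * Orthogonal families of projections *)

Section Measurements.
Variables (R : realType) (H : vectType R[i]) (dot : {dot H for Num.conj}).
Implicit Types (P Q A B U V : 'End(H)) (s t : seq 'End(H)) (M N : {fset 'End(H)}).
Local Notation "f ^†" := (adj dot f).
Local Notation orth_proj := (orth_proj dot).
Local Notation is_pm := (is_pm dot).
Local Notation pm_at := (pm_at dot).
Local Notation partial_isom := (partial_isom dot).

Definition orth_family s : Prop :=
  [/\ uniq s, forall Q, Q \in s -> orth_proj Q /\ Q != 0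
    & forall Q Q', Q \in s -> Q' \in s -> Q != Q' -> orth_ops Q Q'].

Lemma orth_family_perm s t : perm_eq s t -> orth_family s -> orth_family t.
Proof.
move=> st [us ps os]; split; first by rewrite -(perm_uniq st).
  by move=> Q; rewrite -(perm_mem st); apply: ps.
by move=> Q Q'; rewrite -!(perm_mem st); apply: os.
Qed.

Lemma orth_family_cons Q s : orth_family (Q :: s) <->
  [/\ orth_proj Q, Q != 0, orth_family s
    & forall Q', Q' \in s -> orth_ops Q Q'].
Proof.
split=> [[/= /andP[Qs us] ps os] | [Qp Q0 [us ps os] oQ]].
  have [Qp Q0] := ps Q (mem_head _ _); split=> //.
    split=> // [Q' Q's|Q1 Q2 Q1s Q2s]; first by apply: ps; rewrite inE Q's orbT.
    by apply: os; rewrite inE ?Q1s ?Q2s orbT.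
  move=> Q' Q's; apply: os; rewrite ?inE ?eqxx ?Q's ?orbT //.
  by apply: contraNneq Qs => ->.
split=> /=.
(* If [Q] occurred in [s] it would be orthogonal to itself, so that Q = Q Q = 0. *)
- rewrite us andbT; apply: contraNN Q0 => /oQ[QQ _].
  by rewrite -Qp.1 QQ.
- by move=> Q'; rewrite inE => /predU1P[->|/ps].
- move=> Q1 Q2; rewrite !inE => /predU1P[->|Q1s] /predU1P[->|Q2s].
  + by rewrite eqxx.
  + by move=> _; apply: oQ.
  + by move=> _; apply/orth_ops_sym/oQ.
  + exact: os.
Qed.

Lemma orth_ops_sum Q s : (forall Q', Q' \in s -> orth_ops Q Q') ->
  orth_ops Q (\sum_(Q' <- s) Q').
Proof.
elim: s => [|A s IHs] oQ; first by rewrite big_nil; apply: orth_ops0.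
rewrite big_cons; apply: orth_opsD; first by apply: oQ; rewrite mem_head.
by apply: IHs => Q' Q's; apply: oQ; rewrite inE Q's orbT.
Qed.

Lemma orth_proj_sum s : orth_family s -> orth_proj (\sum_(Q <- s) Q).
Proof.
elim: s => [|A s IHs]; first by rewrite big_nil => _; apply: orth_proj0.
case/orth_family_cons => Ap _ /IHs sp oA; rewrite big_cons.
by apply: orth_projD => //; apply: orth_ops_sum.
Qed.

Lemma rk_sum s : orth_family s ->
  rk (\sum_(Q <- s) Q) = sumn [seq rk Q | Q <- s].
Proof.
elim: s => [|A s IHs]; first by rewrite big_nil => _; apply: rk0.
case/orth_family_cons => Ap _ sf oA; rewrite big_cons /= -IHs //.
by apply: (rkD Ap (orth_proj_sum sf)); apply: orth_ops_sum.
Qed.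

(* The cross terms vanish because [V A = V] and [V] kills whatever is
   orthogonal to [A], for [V] a partial isometry with initial projection [A]. *)
Lemma partial_isom_family_cons A B V s t U : orth_family (A :: s) ->
  orth_family (B :: t) -> partial_isom A B V ->
  partial_isom (\sum_(Q <- s) Q) (\sum_(Q <- t) Q) U ->
  [seq (U \o Q \o U^†)%VF | Q <- s] = t ->
  partial_isom (\sum_(Q <- A :: s) Q) (\sum_(Q <- B :: t) Q) (V + U) /\
  [seq ((V + U) \o Q \o (V + U)^†)%VF | Q <- A :: s] = B :: t.
Proof.
move=> /orth_family_cons[Ap _ sf oA] /orth_family_cons[Bp _ tf oB] iV iU UsE.
have oAs := orth_ops_sum oA.
split; first by rewrite !big_cons; apply: partial_isomD => //; apply: orth_ops_sum.
have UA : (U \o A)%VF = 0 by apply: (partial_isom_comp_eq0 iU); case: oAs.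
have VA0 Q : Q \in s -> (V \o Q)%VF = 0.
  by move=> /oA[AQ _]; apply: (partial_isom_comp_eq0 iV).
have adj_eq0 f Q : orth_proj Q -> (f \o Q)%VF = 0 -> (Q \o f^†)%VF = 0.
  by move=> [_ Qs] fQ; rewrite -{1}Qs -adjM fQ adj0.
congr (_ :: _).
  rewrite comp_lfunDl UA addr0 adjD -comp_lfunA comp_lfunDr (adj_eq0 U) // addr0.
  have VA : (V \o A)%VF = V.
    apply/eqP; rewrite -subr_eq0 -{2}[V]comp_lfun1r -comp_lfunNr -comp_lfunDr.
    apply/eqP/(partial_isom_comp_eq0 iV).
    by rewrite comp_lfunDr comp_lfunNr comp_lfun1r Ap.1 subrr.
  by rewrite comp_lfunA VA iV.2.
rewrite -[RHS]UsE; apply/eq_in_map => Q Qs.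
have [_ /(_ _ Qs) [Qp _] _] := sf.
rewrite comp_lfunDl VA0 // add0r adjD -!comp_lfunA comp_lfunDr.
by rewrite (adj_eq0 V) ?VA0 // add0r.
Qed.

Lemma partial_isom_family_exists s t : orth_family s -> orth_family t ->
  [seq rk Q | Q <- s] = [seq rk Q | Q <- t] ->
  exists2 U, partial_isom (\sum_(Q <- s) Q) (\sum_(Q <- t) Q) U
           & [seq (U \o Q \o U^†)%VF | Q <- s] = t.
Proof.
elim: s t => [|A s IHs] [|B t] //.
  by exists 0; rewrite // !big_nil; apply/partial_isom_self/orth_proj0.
move=> Asf Btf [rAB rst].
have /orth_family_cons[Ap _ sf _] := Asf.
have /orth_family_cons[Bp _ tf _] := Btf.
have [V iV] := partial_isom_exists Ap Bp rAB.
have [U iU UsE] := IHs t sf tf rst.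
by exists (V + U); have [] := partial_isom_family_cons Asf Btf iV iU UsE.
Qed.

(** * Measurements containing P, as lists of the other outcomes *)

Definition pm_seq P s : Prop :=
  orth_family (P :: s) /\ P + \sum_(Q <- s) Q = \1%VF.

(* [s] lists the outcomes of [M] other than [P]. *)
Definition pm_list P M s : Prop := pm_at P M /\ perm_eq (M `\ P)%fset s.

Lemma pm_at_list P M : pm_at P M -> pm_list P M (M `\ P)%fset.
Proof. by []. Qed.

Lemma pm_list_perm P M s t : perm_eq s t -> pm_list P M s -> pm_list P M t.
Proof. by move=> st [hM sE]; split=> //; apply: perm_trans st. Qed.

Lemma mem_pm_list P M s : pm_list P M s -> M =i P :: s.
Proof.
move=> [[_ PM] sE] Q; rewrite inE -(perm_mem sE) !inE.
by case: eqVneq => // ->.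
Qed.

Lemma pm_list_uniq P M s : pm_list P M s -> uniq (P :: s).
Proof. by move=> [_ sE] /=; rewrite -(perm_uniq sE) -(perm_mem sE) !inE eqxx /=. Qed.

Lemma pm_list_enum P M s : pm_list P M s -> perm_eq M (P :: s).
Proof.
move=> hM; apply: uniq_perm; rewrite ?fset_uniq ?(pm_list_uniq hM) //.
exact: mem_pm_list.
Qed.

Lemma pm_list_seq P M s : pm_list P M s -> pm_seq P s.
Proof.
move=> hM; have ME := pm_list_enum hM; have [[[p1 p2 p3] _] _] := hM.
split; last by rewrite -p3 (perm_big _ ME) big_cons.
by apply: (orth_family_perm ME); split; first exact: fset_uniq.
Qed.

Lemma pm_seq_list P s : pm_seq P s -> pm_list P [fset Q in P :: s]%fset s.
Proof.
move=> [[us ps os] s1].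
have ME : perm_eq [fset Q in P :: s]%fset (P :: s).
  by apply: uniq_perm => // Q; rewrite in_fset.
split; last first.
  apply: uniq_perm; rewrite ?fset_uniq //; first by case/andP: us.
  move=> Q; rewrite in_fsetD1 in_fset inE; case: eqVneq => [->|] //=.
  by case/andP: us => /negPf ->.
split; last by rewrite !inE eqxx.
split; last by rewrite (perm_big _ ME) /= big_cons.
  by move=> Q; rewrite in_fset; apply: ps.
by move=> Q Q'; rewrite !in_fset; apply: os.
Qed.

Lemma pm_list_inj P M N s : pm_list P M s -> pm_list P N s -> M = N.
Proof.
by move=> hM hN; apply/fsetP => Q; rewrite (mem_pm_list hM) (mem_pm_list hN).
Qed.

(** The sums agree, and a projection is orthogonal to [Q] exactly when it is orthogonal to both
    summands. Read forwards this refines a measurement; read backwards it merges two outcomes. *)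
Lemma pm_seq_split P Q Q1 Q2 s : Q = Q1 + Q2 ->
    orth_proj Q1 -> orth_proj Q2 -> Q1 != 0 -> Q2 != 0 -> orth_ops Q1 Q2 ->
  pm_seq P (Q :: s) <-> pm_seq P (Q1 :: Q2 :: s).
Proof.
move=> QE p1 p2 n1 n2 o12; have o21 := orth_ops_sym o12.
have sE : \sum_(X <- Q :: s) X = \sum_(X <- Q1 :: Q2 :: s) X.
  by rewrite !big_cons QE addrA.
split=> -[f1 s1]; (split; last by rewrite -s1 sE).
- case/orth_family_cons: f1 => Pp P0 /orth_family_cons[Qp Q0 sf oQ] oP.
  have oX X : orth_proj X -> orth_ops X Q -> orth_ops X Q1 /\ orth_ops X Q2.
    rewrite QE => Xp XQ; split; first exact: (@orth_ops_addl _ _ dot X Q1 Q2).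
    by apply: (@orth_ops_addl _ _ dot X Q2 Q1) => //; rewrite addrC.
  have oXs X : X \in s -> orth_ops X Q1 /\ orth_ops X Q2.
    move=> Xs; have [_ /(_ _ Xs)[Xp _] _] := sf.
    by apply: oX => //; apply/orth_ops_sym/oQ.
  have [oP1 oP2] := oX P Pp (oP _ (mem_head _ _)).
  apply/orth_family_cons; split; [exact: Pp|exact: P0| |].
    apply/orth_family_cons; split; [exact: p1|exact: n1| |].
      apply/orth_family_cons; split; [exact: p2|exact: n2|exact: sf|].
      by move=> X /oXs[_ /orth_ops_sym].
    by move=> X; rewrite inE => /predU1P[->//|/oXs[/orth_ops_sym]].
  move=> X; rewrite !inE => /or3P[/eqP->|/eqP->|Xs] //.
  by apply: oP; rewrite inE Xs orbT.
- case/orth_family_cons: f1 => Pp P0.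
  move=> /orth_family_cons[_ _ /orth_family_cons[_ _ sf o2] o1] oP.
  apply/orth_family_cons; split; [exact: Pp|exact: P0| |].
    apply/orth_family_cons; split; [|  |exact: sf|].
    + by rewrite QE; apply: orth_projD.
    (* Were the sum zero, Q1 = - Q2 would give Q1 = Q1 Q1 = - Q2 Q1 = 0. *)
    + apply: contraNneq n1 => Q0.
      have Q1E : Q1 = - Q2 by apply/eqP; rewrite -addr_eq0 -QE Q0.
      by rewrite -p1.1 {1}Q1E comp_lfunNl o21.1 oppr0.
    + move=> X Xs; rewrite QE; apply/orth_ops_sym/orth_opsD; apply: orth_ops_sym.
        by apply: o1; rewrite inE Xs orbT.
      exact: o2.
  move=> X; rewrite inE => /predU1P[->|Xs].
    by rewrite QE; apply: orth_opsD; apply: oP; rewrite !inE eqxx ?orbT.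
  by apply: oP; rewrite !inE Xs !orbT.
Qed.

Lemma pm_list_refines P M M' Q Q1 Q2 s : Q = Q1 + Q2 -> pm_list P M (Q :: s) ->
  pm_list P M' (Q1 :: Q2 :: s) -> refines dot P M' M.
Proof.
move=> QE hM hM'; have /and3P[/= PQs Qs _] := pm_list_uniq hM.
have PQ : P != Q by move: PQs; rewrite inE negb_or => /andP[].
split; [by case: hM => -[] | by case: hM' => -[] |].
have [/orth_family_cons[_ _ /orth_family_cons[p1 n1 f1 o1] _] _] := pm_list_seq hM'.
have /orth_family_cons[p2 n2 _ _] := f1.
exists Q, Q1, Q2; split => //.
- by rewrite (mem_pm_list hM) !inE eqxx orbT.
- by split=> //; apply: o1; rewrite mem_head.
- apply/fsetP => X; rewrite (mem_pm_list hM') !inE (mem_pm_list hM) !inE.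
  case: (eqVneq X Q) => [->|_] /=; last first.
    by case: (X == P); case: (X == Q1); case: (X == Q2); case: (X \in s).
  by rewrite eq_sym (negPf PQ) (negPf Qs) !orbF.
- by rewrite !inE PQ (mem_pm_list hM) mem_head.
Qed.

Lemma pm_list_split P M Q (a b : nat) s : pm_list P M (Q :: s) ->
  rk Q = (a + b)%N -> (0 < a)%N -> (0 < b)%N ->
  exists M' Q1 Q2, [/\ pm_list P M' (Q1 :: Q2 :: s), refines dot P M' M,
                    rk Q1 = a & rk Q2 = b].
Proof.
move=> hM rQ a0 b0; have hs := pm_list_seq hM.
have [/orth_family_cons[_ _ /orth_family_cons[Qp _ _ _] _] _] := hs.
have [Q1 [Q2 [p1 p2 o12 QE [r1 r2]]]] := orth_proj_split Qp rQ.
have n1 : Q1 != 0 by rewrite -rk_eq0 r1 -lt0n.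
have n2 : Q2 != 0 by rewrite -rk_eq0 r2 -lt0n.
have /pm_seq_list hM' := (pm_seq_split P s QE p1 p2 n1 n2 o12).1 hs.
eexists; exists Q1, Q2; split; [exact: hM'| |exact: r1|exact: r2].
exact: pm_list_refines QE hM hM'.
Qed.

Lemma pm_list_merge P M Q1 Q2 s : pm_list P M (Q1 :: Q2 :: s) ->
  exists M' Q, [/\ pm_list P M' (Q :: s), refines dot P M M'
                 & rk Q = (rk Q1 + rk Q2)%N].
Proof.
move=> hM; have hs := pm_list_seq hM.
have [/orth_family_cons[_ _ /orth_family_cons[p1 n1 f1 o1] _] _] := hs.
have /orth_family_cons[p2 n2 _ _] := f1.
have o12 := o1 Q2 (mem_head _ _); have rQ := rkD p1 p2 o12.
have [Q QE] : exists Q, Q = Q1 + Q2 by exists (Q1 + Q2).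
rewrite -QE in rQ.
have /pm_seq_list hM' := (pm_seq_split P s QE p1 p2 n1 n2 o12).2 hs.
eexists; exists Q; split; [exact: hM'| |exact: rQ].
exact: pm_list_refines QE hM' hM.
Qed.

(** * Rank profiles *)

Lemma rank_profile_list P M s : pm_list P M s ->
  rank_profile P M = sort leq [seq rk Q | Q <- s].
Proof.
move=> [_ sE]; apply/perm_sortP; first exact: leq_total.
- exact: leq_trans.
- exact: anti_leq.
- exact: perm_map.
Qed.

Lemma kP_list P M s : pm_list P M s -> kP P M = size s.
Proof. by move=> [_ /perm_size <-]. Qed.

Lemma rank_profile_partition P M : pm_at P M ->
  is_partition (codim P) (rank_profile P M).
Proof.
move=> /pm_at_list/pm_list_seq[f1 s1].
have sp := sort_sorted leq_total [seq rk Q | Q <- (M `\ P)%fset].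
rewrite /is_partition sp /=; apply/andP; split.
  rewrite all_sort all_map; apply/allP => Q Qs /=.
  by case: f1 => _ /(_ Q); rewrite inE Qs orbT lt0n rk_eq0 => /(_ isT)[].
(* Taking ranks in the completeness relation shows that the ranks of the outcomes, including [P],
   add up to the dimension. *)
have := rk_sum f1; rewrite big_cons s1 rk1 /= /codim => ->; rewrite addKn.
by rewrite /rank_profile (perm_sumn (permEl (perm_sort _ _))).
Qed.

Lemma size_rank_profile P M : size (rank_profile P M) = kP P M.
Proof. by rewrite size_sort size_map. Qed.

(** * The action of the unitaries fixing the range of P *)

Lemma fixes_range_conj P U : orth_proj P -> fixes_range dot P U ->
  (U \o P \o U^†)%VF = P.
Proof.
move=> [Pi Ps] [_ UP].
have UPE : (U \o P)%VF = P.
  by apply/lfunP => x; rewrite comp_lfunE UP // memv_img ?memvf.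
by rewrite UPE -{1}Ps -adjM UPE Ps.
Qed.

(** Conjugation by [U] is injective, additive, multiplicative and compatible with adjoints, so it
    preserves each clause of being a measurement; it fixes [P] because [U] fixes the range of
    [P]. *)
Lemma pm_list_conj P M s U : pm_list P M s -> fixes_range dot P U ->
  pm_list P (conj_pm dot U M) [seq (U \o Q \o U^†)%VF | Q <- s].
Proof.
move=> hM hU; have [[us ps os] s1] := pm_list_seq hM.
have [[U1 U2] _] := hU.
pose c Q : 'End(H) := (U \o Q \o U^†)%VF.
have cM A B : (c A \o c B)%VF = c (A \o B)%VF.
  rewrite /c -!comp_lfunA [X in (U \o (A \o X))%VF]comp_lfunA U1 comp_lfun1l.
  by rewrite comp_lfunA.
have cD A B : c (A + B) = c A + c B by rewrite /c comp_lfunDr comp_lfunDl.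
have c0 : c 0 = 0 by rewrite /c comp_lfun0r comp_lfun0l.
have c_inj : injective c.
  apply: (can_inj (g := fun X => U^† \o X \o U)%VF) => X.
  by rewrite /c -!comp_lfunA U1 comp_lfun1r comp_lfunA U1 comp_lfun1l.
have PE : c P = P by apply: fixes_range_conj => //; apply: (ps P _).1; rewrite mem_head.
have csE : map c (P :: s) = P :: map c s by rewrite /= PE.
have hcs : pm_seq P (map c s).
  split; last first.
    rewrite big_map -{1}PE; have -> : \sum_(Q <- s) c Q = c (\sum_(Q <- s) Q).
      by apply/esym/big_morph.
    by rewrite -cD s1 /c comp_lfun1r U2.
  rewrite -csE; split; first by rewrite map_inj_uniq.
    move=> _ /mapP[Q /ps[[Qi Qs] Q0] ->]; split; last first.
      by apply: contraNneq Q0 => cQ0; apply/eqP/c_inj; rewrite c0.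
    by split; [rewrite cM Qi | rewrite /c !adjM adjK Qs comp_lfunA].
  move=> _ _ /mapP[A As ->] /mapP[B Bs ->] cAB.
  have [|AB BA] := os A B As Bs; first by apply: contraNneq cAB => ->.
  by split; rewrite cM ?AB ?BA c0.
suff -> : conj_pm dot U M = [fset Q in P :: map c s]%fset by exact: pm_seq_list.
apply/fsetP => X; rewrite in_fset -csE; apply/imfsetP/mapP => -[Q QM ->];
  by exists Q => //; move: QM; rewrite /= (mem_pm_list hM).
Qed.

Lemma pm_same_profile P M N : orth_proj P -> pm_at P M -> pm_at P N ->
  rank_profile P M = rank_profile P N ->
  exists2 U, fixes_range dot P U & conj_pm dot U M = N.
Proof.
move=> Pp /pm_at_list hM /pm_at_list hN.
(* Equal sorted profiles mean that the rank lists are permutations of each other, so the outcomes of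
   [M] can be listed with the same ranks, in the same order, as those of [N]. *)
move/(perm_sortP leq_total leq_trans anti_leq)/perm_map_exists => [s Ms rs].
have {}hM := pm_list_perm Ms hM.
have [fM sM] := pm_list_seq hM; have [fN sN] := pm_list_seq hN.
have /orth_family_cons[_ _ sf oPs] := fM.
have /orth_family_cons[_ _ tf _] := fN.
have [U iU UsE] := partial_isom_family_exists sf tf rs.
(* [P] serves as the partial isometry from its own range to itself. By completeness of both
   measurements the initial and final projections of [P + U] are the identity, so [P + U] is
   unitary. *)
have [iPU PUE] := partial_isom_family_cons fM fN (partial_isom_self Pp) iU UsE.
have [_ oP] := orth_ops_sum oPs.
have hU : fixes_range dot P (P + U).
  split; first by move: iPU; rewrite !big_cons sM sN.
  move=> _ /memv_imgP[x _ ->].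
  (* The initial projection of [U] is the sum of the outcomes of [M] other than [P], which is
     orthogonal to [P]. *)
  have UP : (U \o P)%VF = 0.
    exact: (partial_isom_comp_eq0 iU).
  by rewrite add_lfunE -!comp_lfunE UP zero_lfunE addr0 Pp.1.
exists (P + U) => //.
move: PUE => [_ PUE]; have := pm_list_conj hM hU; rewrite PUE => hc.
exact: pm_list_inj hc hN.
Qed.

End Measurements.

(** * Walks and distances in the graph of partitions *)

Section PartitionGraph.
Variable n : nat.
Implicit Types s t u : seq nat.

Lemma Gamma_sym : symmetric (Gamma n).
Proof.
move=> s t; rewrite /Gamma andbCA; do 2!congr andb.
by apply/asboolP/asboolP => -[]; [right|left|right|left].
Qed.

Lemma walk0 s : walk n s s 0.
Proof. by exists [::]. Qed.

Lemma walk_step s t u k : Gamma n s t -> walk n t u k -> walk n s u k.+1.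
Proof. by move=> st [p [tp pu pk]]; exists (t :: p); rewrite /= st tp pu pk. Qed.

Lemma walk_cat s t u j k : walk n s t j -> walk n t u k -> walk n s u (j + k).
Proof.
move=> [p [sp pt <-]] [q [tq qu <-]]; exists (p ++ q).
by rewrite cat_path last_cat size_cat pt sp tq.
Qed.

Lemma walk_sym s t k : walk n s t k -> walk n t s k.
Proof.
move=> [p [sp <- <-]]; exists (rev (belast s p)).
rewrite size_rev size_belast rev_path; split=> //.
  by rewrite (eq_path (e' := Gamma n)) // => x y; apply: Gamma_sym.
by case: p {sp} => //= x p; rewrite rev_cons last_rcons.
Qed.

(** Once some walk exists, the set of minimal lengths is nonempty, so [xget] returns a true minimum
    and not its default 0. *)
Lemma pdistP s t k : walk n s t k ->
  walk n s t (pdist n s t) /\ (pdist n s t <= k)%N.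
Proof.
move=> wk; have ex : exists k, `[< walk n s t k >] by exists k; apply/asboolP.
suff [w le] : [set k | walk n s t k /\ forall j, walk n s t j -> (k <= j)%N]%classic
    (pdist n s t) by split=> //; apply: le.
apply: xgetPex; exists (ex_minn ex); case: ex_minnP => m /asboolP wm min_m.
by split=> // j /asboolP/min_m.
Qed.

Lemma partition_size s : is_partition n s -> (size s <= n)%N.
Proof.
move=> /and3P[_ + /eqP <-]; elim: s => //= r s IHs /andP[r0 /IHs].
by move=> ss; rewrite -addn1 addnC leq_add.
Qed.

(** Splitting a 1 off a part larger than 1 adds one part, and this can go on until there are [n]
    parts. *)
Lemma walk_ones s : is_partition n s -> walk n s (nseq n 1%N) (n - size s).
Proof.
move: {2}(n - size s)%N (erefl (n - size s)%N) => k.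
elim: k s => [|k IHk] s sk sn.
  have /and3P[_ s0 /eqP sumE] := sn.
  (* With as many parts as the total, no part can exceed 1. *)
  have sizeE : size s = n.
    by apply/eqP; rewrite eqn_leq partition_size //= -subn_eq0 sk.
  suff -> : nseq n 1%N = s by rewrite sk; apply: walk0.
  rewrite -sizeE; apply/esym/all_pred1P.
  have : (sumn s <= size s)%N by rewrite sumE sizeE.
  elim: s s0 {sk sn sumE sizeE} => //= r s IHs /andP[r0 s0] le.
  have ls : (size s <= sumn s)%N.
    elim: s s0 {IHs le} => //= x s IHs /andP[x0 /IHs].
    by move=> ss; rewrite -add1n leq_add.
  have r1 : (r <= 1)%N by rewrite -(leq_add2r (sumn s)) (leq_trans le) // -add1n leq_add2l.
  have {r0 r1} rE : r = 1%N by apply/eqP; rewrite eqn_leq r1.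
  by rewrite rE eqxx IHs //; move: le; rewrite rE -add1n leq_add2l.
have /and3P[ss s0 /eqP sumE] := sn.
(* If every part were 1 there would be [n] of them, whereas [n - size s] is a successor. *)
have [r rs r1] : exists2 r, r \in s & (1 < r)%N.
  apply: contrapT => h; have s1 : all (pred1 1%N) s.
    apply/allP => r rs /=; move/allP/(_ r rs): s0 => r0.
    rewrite eqn_leq r0 andbT leqNgt; apply/negP => r1; apply: h; by exists r.
  move/all_pred1P: s1 => sE; move: sumE; rewrite sE sumn_nseq mul1n => nE.
  by move: sk; rewrite -{1}nE subnn.
pose t := sort leq [:: 1, r.-1 & rem r s]%N.
have r1E : (1 + r.-1)%N = r by rewrite add1n prednK // ltnW.
have tE : perm_eq t [:: 1, r.-1 & rem r s]%N by rewrite perm_sort.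
have sE := perm_to_rem rs.
have tn : is_partition n t.
  rewrite /is_partition (sort_sorted leq_total) (perm_all _ tE) (perm_sumn tE) /=.
  rewrite addnA r1E -sumE (perm_sumn sE) /= eqxx andbT -ltnS prednK ?(ltnW r1) // r1 /=.
  by move: s0; rewrite (perm_all _ sE) => /andP[].
have st : (size t = (size s).+1)%N by rewrite (perm_size tE) /= (perm_size sE).
have tk : (n - size t)%N = k by rewrite st subnS sk.
rewrite sk; apply: (walk_step (t := t)); last by rewrite -tk; apply: IHk.
rewrite /Gamma sn tn /=; apply/asboolP; left; exists r, 1%N, r.-1.
by split=> //; rewrite -ltnS prednK // ltnW.
Qed.

Lemma pdist_le s t : is_partition n s -> is_partition n t ->
  walk n s t (pdist n s t) /\
  (pdist n s t <= (n - size s) + (n - size t))%N.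
Proof.
move=> /walk_ones ws /walk_ones wt.
exact: (pdistP (walk_cat ws (walk_sym wt))).
Qed.

End PartitionGraph.

(** The bound 1 makes the supremum dominate the members; nonnegativity for the empty family comes
    from its supremum being 0. *)
Lemma sup_unit_interval (R : realType) (E : set R) :
  (forall r, E r -> 0 <= r <= 1) -> 0 <= sup E /\ forall r, E r -> r <= sup E.
Proof.
move=> E01; have le r : E r -> r <= sup E.
  by apply: ub_le_sup; exists 1 => x /E01/andP[].
split=> //; case: (pselect (E !=set0)%classic) => [[r Er]|].
  by apply: le_trans (le r Er); case/andP: (E01 r Er).
by move/set0P/negP; rewrite negbK => /eqP ->; rewrite sup0.
Qed.

(** The empty family has supremum 0, and this case is covered by [0 <= x]. *)
Lemma sup_le_nneg (R : realType) (E : set R) x :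
  0 <= x -> (forall r, E r -> r <= x) -> sup E <= x.
Proof.
move=> x0 Ex; case: (pselect (E !=set0)%classic) => [E0|]; first exact: ge_sup.
by move/set0P/negP; rewrite negbK => /eqP ->; rewrite sup0.
Qed.

(** * Bounds by coarsening and by lifting walks *)

Section Bounds.
Variables (R : realType) (H : vectType R[i]) (dot : {dot H for Num.conj}).
Variable w : 'End(H) -> {fset 'End(H)} -> R.
Hypothesis hw : assignment dot w.
Variable P : 'End(H).
Hypothesis hP : orth_proj dot P.
Implicit Types (M N : {fset 'End(H)}) (s t : seq 'End(H)).
Local Notation pm_at := (pm_at dot P).
Local Notation pm_list := (pm_list dot P).
Local Notation D := (defref dot w P).
Local Notation G := (defG dot w P).

Lemma assignment_dist M N : pm_at M -> pm_at N -> 0 <= `|w P M - w P N| <= 1.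
Proof.
move=> [/hw[wM _] PM] [/hw[wN _] PN]; rewrite normr_ge0 /=.
have /andP[M0 M1] := wM P PM; have /andP[N0 N1] := wN P PN.
have le1 (a b : R) : 0 <= a -> b <= 1 -> b - a <= 1.
  by move=> a0 b1; rewrite lerBlDr (le_trans b1) // lerDl.
by rewrite ler_norml lerNl opprB !le1.
Qed.

Lemma refines_pm_at M M' : refines dot P M' M -> pm_at M /\ pm_at M'.
Proof.
move=> [hM hM' [Q [Q1 [Q2 [_ _ _ M'E PQ]]]]].
split; split=> //; first by move: PQ; rewrite !inE => /andP[].
by rewrite M'E inE PQ.
Qed.

Lemma conj_pm_at M U : pm_at M -> fixes_range dot P U -> pm_at (conj_pm dot U M).
Proof. by move=> /pm_at_list hM /(pm_list_conj hM)[]. Qed.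

Lemma defref_sup : 0 <= D /\ forall M M', refines dot P M' M ->
  `|w P M' - w P M| <= D.
Proof.
have [|D0 leD] := @sup_unit_interval R [set r : R | exists M M',
    refines dot P M' M /\ r = `|w P M' - w P M| ]%classic.
  by move=> _ [M [M' [/refines_pm_at[hM hM'] ->]]]; apply: assignment_dist.
by split=> // M M' MM'; apply: leD; exists M, M'.
Qed.

Lemma defG_sup : 0 <= G /\ forall M U, pm_at M -> fixes_range dot P U ->
  `|w P (conj_pm dot U M) - w P M| <= G.
Proof.
have [|G0 leG] := @sup_unit_interval R [set r : R | exists M U,
    [/\ pm_at M, fixes_range dot P U & r = `|w P (conj_pm dot U M) - w P M| ]]%classic.
  by move=> _ [M [U [hM hU ->]]]; apply: assignment_dist => //; apply: conj_pm_at.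
by split=> // M U hM hU; apply: leG; exists M, U.
Qed.

(** Merging the first two listed outcomes costs one refinement defect and shortens the list by one,
    until at most one outcome besides [P] is left. *)
Lemma coarsen M : pm_at M -> exists N s,
  [/\ pm_list N s, (size s <= 1)%N & `|w P M - w P N| <= (cP P M)%:R * D].
Proof.
move=> /pm_at_list hM; rewrite /cP (kP_list hM) maxn0.
move: {2}(size _) (erefl (size (M `\ P)%fset)) hM => k.
move: (enum_fset _) => s; elim: k M s => [|k IHk] M [|Q1 [|Q2 s]] // sk hM.
(* Nothing to merge: [P] is the only outcome here, and has a single companion in the next case. *)
- by exists M, [::]; rewrite subrr normr0 mul0r.
- by exists M, [:: Q1]; rewrite subrr normr0 mul0r.
have [M' [Q [hM' MM' _]]] := pm_list_merge hM.
have [|N [t [hN t1 NM']]] := IHk M' _ _ hM'; first by case: sk.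
exists N, t; split=> //; rewrite (le_trans (ler_distD (w P M') _ _)) //.
rewrite /= subn1 /= -natr1 mulrDl mul1r addrC lerD //.
- by move: NM'; rewrite /= subn1.
- exact: defref_sup.2.
Qed.

Lemma pm_list_small M N s t : pm_list M s -> pm_list N t ->
  (size s <= 1)%N -> (size t <= 1)%N -> M = N.
Proof.
move=> hM hN s1 t1; suff st : s = t by rewrite st in hM; apply: pm_list_inj hN.
have [/orth_family_cons[_ _ sf _]] := pm_list_seq hM.
have [/orth_family_cons[_ _ tf _]] := pm_list_seq hN.
(* Cancelling [P] from the two completeness relations equates the sums of the lists. An empty list
   cannot match a singleton, whose entry is nonzero. *)
move=> <- /addrI; case: s t s1 t1 sf tf {hM hN} => [|Q [|//]] [|Q' [|//]] // _ _.
- move=> _ /orth_family_cons[_ Q0 _ _]; rewrite big_nil big_seq1.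
  by move/esym/eqP; rewrite (negPf Q0).
- move=> /orth_family_cons[_ Q0 _ _] _; rewrite big_nil big_seq1 => /eqP.
  by rewrite (negPf Q0).
- by rewrite !big_seq1 => _ _ ->.
Qed.

Lemma dist_le_coarse M N : pm_at M -> pm_at N ->
  `|w P M - w P N| <= (cP P M + cP P N)%:R * D.
Proof.
move=> /coarsen[M0 [s [hM s1 leM]]] /coarsen[N0 [t [hN t1 leN]]].
rewrite (le_trans (ler_distD (w P M0) _ _)) // natrD mulrDl lerD //.
by rewrite (pm_list_small hM hN) // distrC.
Qed.

Lemma rank_profile_eq n M s r : pm_list M s -> is_partition n r ->
  perm_eq r [seq rk Q | Q <- s] -> rank_profile P M = r.
Proof.
move=> hM /and3P[sr _ _] rs; rewrite (rank_profile_list hM).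
apply: (sorted_eq leq_trans anti_leq) => //; first exact: sort_sorted leq_total _.
by rewrite perm_sort perm_sym.
Qed.

(** Brings outcomes whose ranks are about to be split or merged to the head of the list. *)
Lemma pm_list_profile M r : pm_at M -> perm_eq (rank_profile P M) r ->
  exists2 s, pm_list M s & map (@rk R H) s = r.
Proof.
move=> /pm_at_list hM Mr.
have /perm_map_exists[s Ms sr] : perm_eq [seq rk Q | Q <- (M `\ P)%fset] r.
  by apply: perm_trans Mr; rewrite perm_sym perm_sort.
by exists s => //; apply: pm_list_perm hM.
Qed.

Lemma lift_edge n M r : pm_at M -> Gamma n (rank_profile P M) r ->
  exists N, [/\ pm_at N, rank_profile P N = r & `|w P M - w P N| <= D].
Proof.
move=> hM /and3P[_ rn /asboolP[]].
  (* The edge splits a part [q] of the profile of [M]: refine an outcome of that rank. *)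
  move=> [q [a [b [qM a0 b0 abE rE]]]].
  have [[//|Q s] hMs [Qq sE]] := pm_list_profile hM (perm_to_rem qM).
  have [|N [Q1 [Q2 [hN MN r1 r2]]]] := pm_list_split hMs _ a0 b0; first by rewrite Qq.
  exists N; split; first by case: hN.
    by apply: (rank_profile_eq hN rn); rewrite /= r1 r2 sE.
  by rewrite distrC; apply: defref_sup.2.
(* The edge runs the other way: merge two outcomes of ranks [a] and [b]. *)
move=> [q [a [b [qr a0 b0 abE ME]]]].
have [[//|Q1 [//|Q2 s]] hMs [r1 r2 sE]] := pm_list_profile hM ME.
have [N [Q [hN MN rQ]]] := pm_list_merge hMs.
exists N; split; first by case: hN.
  apply: (rank_profile_eq hN rn); rewrite (permPl (perm_to_rem qr)) /= rQ r1 r2 sE.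
  by rewrite abE.
exact: defref_sup.2.
Qed.

Lemma lift_walk n M r k : pm_at M -> walk n (rank_profile P M) r k ->
  exists N, [/\ pm_at N, rank_profile P N = r & `|w P M - w P N| <= k%:R * D].
Proof.
move=> hM [p [+ <- <-]]; elim: p M hM => [|q p IHp] M hM /=.
  by exists M; rewrite subrr normr0 mul0r.
case/andP => /(lift_edge hM)[M' [hM' <- le1]] /(IHp _ hM')[N [hN rN le2]].
exists N; split=> //; rewrite (le_trans (ler_distD (w P M') _ _)) //.
by rewrite -natr1 mulrDl mul1r addrC lerD.
Qed.

Lemma dist_le_walk n M N k : pm_at M -> pm_at N ->
  walk n (rank_profile P M) (rank_profile P N) k ->
  `|w P M - w P N| <= k%:R * D + G.
Proof.
move=> hM hN /(lift_walk hM)[M' [hM' rE le1]].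
have [U hU <-] := pm_same_profile hP hM' hN rE.
rewrite (le_trans (ler_distD (w P M') _ _)) // lerD // distrC.
exact: defG_sup.2.
Qed.

Lemma dist_le_pdist M N : pm_at M -> pm_at N ->
  `|w P M - w P N| <= (pdist (codim P) (rank_profile P M) (rank_profile P N))%:R * D + G
  /\ (pdist (codim P) (rank_profile P M) (rank_profile P N) <= sP P M + sP P N)%N.
Proof.
move=> hM hN.
have [] := pdist_le (rank_profile_partition hM) (rank_profile_partition hN).
by rewrite !size_rank_profile => /(dist_le_walk hM hN).
Qed.

Lemma kP_le M : pm_at M -> (kP P M <= codim P)%N.
Proof.
by move=> /rank_profile_partition/partition_size; rewrite size_rank_profile.
Qed.

Lemma cP_le M : pm_at M -> (cP P M <= mP P)%N.
Proof. by move=> /kP_le kM; rewrite /cP /mP !maxn0 leq_sub2r. Qed.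

Lemma cP_sP M : pm_at M -> (cP P M + sP P M = mP P)%N.
Proof.
move=> hM; have := kP_le hM; rewrite /cP /sP /mP !maxn0.
(* The truncated subtractions need this case apart: without outcomes besides [P] the codimension is
   0 and all three numbers vanish. Otherwise (k - 1) + (n - k) = n - 1. *)
have k0 : kP P M = 0%N -> codim P = 0%N.
  have /and3P[_ _ /eqP <-] := rank_profile_partition hM.
  by rewrite -size_rank_profile => /size0nil ->.
case: (kP P M) k0 => [->//|k] _ kn; rewrite !subn1 /=.
by case: (codim P) kn => // n; rewrite ltnS subSS => /subnKC.
Qed.

(** Both [M] and its conjugate contain [P], so the bound by coarsening compares them, each side
    costing at most [mP P] steps. *)
Lemma defG_le : G <= 2 * (mP P)%:R * D.
Proof.
apply: sup_le_nneg; first by rewrite !mulr_ge0 // defref_sup.1.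
move=> _ [M [U [hM hU ->]]]; have hUM := conj_pm_at hM hU.
rewrite (le_trans (dist_le_coarse hUM hM)) // ler_wpM2r ?defref_sup.1 //.
by rewrite -natrM ler_nat mul2n -addnn leq_add // cP_le.
Qed.

Lemma osc_le : osc dot w P <= (mP P)%:R * D + 2^-1 * G.
Proof.
have [D0 G0] := (defref_sup.1, defG_sup.1).
apply: sup_le_nneg; first by rewrite addr_ge0 ?mulr_ge0 ?invr_ge0.
move=> _ [M [N [hM hN ->]]].
have le1 := dist_le_coarse hM hN.
have [le2 led] := dist_le_pdist hM hN.
have {}le2 : `|w P M - w P N| <= (sP P M + sP P N)%:R * D + G.
  by rewrite (le_trans le2) // lerD2r ler_wpM2r // ler_nat.
(* Adding the two bounds on the distance pairs each [cP] with the [sP] of the same measurement, and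
   each pair sums to [mP P]. *)
have mE : 2 * ((mP P)%:R * D) = (cP P M + cP P N)%:R * D + (sP P M + sP P N)%:R * D.
  by rewrite mulrA -natrM -mulrDl -natrD addnACA !cP_sP // mul2n addnn.
rewrite -(ler_pM2l (ltr0n R 2)) mulrDr mE mulVKf ?pnatr_eq0 // -addrA.
by rewrite [leLHS]mulr_natl mulr2n lerD.
Qed.

End Bounds.

Theorem theorem5p6 (R : realType) (H : vectType R[i])
    (dot : {dot H for Num.conj}) (hd : (2 <= \dim {:H})%N)
    (w : 'End(H) -> {fset 'End(H)} -> R) (hw : assignment dot w)
    (P : 'End(H)) (hP : orth_proj dot P) (hP0 : P != 0) :
  [/\ forall M N : {fset 'End(H)}, pm_at dot P M -> pm_at dot P N ->
        `|w P M - w P N| <=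
          Num.min ((cP P M + cP P N)%:R * defref dot w P)
            ((pdist (codim P) (rank_profile P M) (rank_profile P N))%:R
               * defref dot w P + defG dot w P),
      forall M N : {fset 'End(H)}, pm_at dot P M -> pm_at dot P N ->
        `|w P M - w P N| <=
          Num.min ((cP P M + cP P N)%:R * defref dot w P)
            ((sP P M + sP P N)%:R * defref dot w P + defG dot w P),
      defG dot w P <= 2 * (mP P)%:R * defref dot w P,
      osc dot w P <= (mP P)%:R * defref dot w P + 2^-1 * defG dot w P
    & (mP P)%:R * defref dot w P + 2^-1 * defG dot w P
        <= 2 * (mP P)%:R * defref dot w P].
Proof.
have [D0 _] := defref_sup hw P; split.
- move=> M N hM hN; rewrite le_min dist_le_coarse //=.
  by have [] := dist_le_pdist hw hP hM hN.
- move=> M N hM hN; rewrite le_min dist_le_coarse //=.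
  have [le1 le2] := dist_le_pdist hw hP hM hN.
  by rewrite (le_trans le1) // lerD2r ler_wpM2r // ler_nat.
- exact: defG_le.
- exact: osc_le.
(* After one copy of [(mP P)%:R * defref dot w P] is cancelled, what remains is half of the bound on
   [defG]. *)
- rewrite -mulrA [leRHS]mulr_natl mulr2n lerD2l (ler_pdivrMl _ _ (ltr0n R 2)).
  by rewrite mulrA; exact: defG_le.
Qed.
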